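(* For an integer $j\geq 2$, define \[ \Delta_j^P:=\limsup_{n\to\infty}\frac{s_j(n)}{n}-\liminf_{n\to\infty}\frac{s_j(n)}{n}. \] Then for every integer $j\ge 2$, \[ \Delta_j^P\geq \frac{j-1}{(j+4)!}. \] In particular, for every fixed integer $j\geq 2$, the limit $\lim_{n\to\infty} s_j(n)/n$ does not exist. Moreover, there is an absolute constant $C>0$ such that for every integer $j\ge 2$, \[ \frac{1}{(j+2)!}\leq \liminf_{n\to\infty}\frac{s_j(n)}{n}\leq \limsup_{n\to\infty}\frac{s_j(n)}{n}\leq \exp\left(-\frac{j}{e}+C\log j\right). \]
   Context: For a positive integer $n$, define the iterated remainder sets \[ S_0(n):=\{1,2,\ldots,\lfloor n/2\rfloor\},\qquad S_{j+1}(n):=\{n\bmod k : k\in S_j(n)\setminus\{0\}\}\quad (j\ge 0), \] where $n \bmod k$ is the least nonnegative residue of $n$ modulo $k$, and put $s_j(n):=|S_j(n)|$. Logarithms are natural. *)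

(* Defs.v *)
From HB Require Import structures.
From mathcomp Require Import all_boot all_order all_algebra finmap.
From mathcomp Require Import all_classical all_reals all_analysis.
Import Order.TTheory GRing.Theory Num.Theory.
Import numFieldNormedType.Exports.
Set Implicit Arguments.
Unset Strict Implicit.
Unset Printing Implicit Defensive.
Local Open Scope ring_scope.

Fixpoint iterRem (j n : nat) : {fset nat} :=
  if j is i.+1 then [fset (n %% k)%N | k in (iterRem i n `\ 0%N)%fset]%fset
  else [fset k in iota 1 (n %/ 2)]%fset.

Definition cardRem (j n : nat) : nat := #|` iterRem j n|%fset.

(* The value at n = 0 is 0 / 0 = 0.  Passing to remainders does not increase
   the cardinality, so all values lie in [0, 1/2] and the library's
   real-valued limn_sup and limn_inf below are the genuine limsup and liminf. *)
Definition remDensity (R : realType) (j : nat) : R^nat :=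
  fun n => (cardRem j n)%:R / n%:R.

Definition DeltaP (R : realType) (j : nat) : R :=
  limn_sup (remDensity R j) - limn_inf (remDensity R j).

(* Main.v *)
Require Import Defs.
From mathcomp Require Import all_boot all_order all_algebra finmap.
From mathcomp Require Import all_classical all_reals all_analysis.
From mathcomp Require Import zify ring lra.
Set Implicit Arguments.
Unset Strict Implicit.
Unset Printing Implicit Defensive.
Import Order.TTheory GRing.Theory Num.Theory.
Import numFieldNormedType.Exports.
Local Open Scope ring_scope.

(** Why the theorem holds.

    Going from a remainder [k] to a remainder [r = n mod k > 0] means
    [r = n - q k] with [r < k], and then [q k < n < (q + 1) k].  Along a chain of
    iterated remainders the quotients [q] are therefore at least 2 and strictly
    increase, and conversely every increasing sequence of [j] quotients
    [2 <= q_1 < ... < q_j] arises, for exactly those [r > 0] which lie in one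
    residue class modulo [q_1 ... q_j] (the class of [n b], where the integer [b]
    depends only on the quotients) and satisfy [r (q_j + 1) < n].  So, up to the
    element 0, the [j]-th set is a union of residue classes, each cut off at
    [n / (q_j + 1)]; this is [mem_iterRem].

    Lower bound on the lower limit: the quotients [2, 3, ..., j + 1] alone give
    density [1 / ((j + 2) (j + 1)!)] ([cardRem_ge]).

    Upper bound on the upper limit: by the union bound the density is at most
    the sum of [1 / (q_1 ... q_j (q_j + 1))] over the chains with [q_j <= K], plus
    [1 / (K + 2)] for the elements that need a larger quotient.  The sum over all
    chains of length [j] below [q] of the reciprocals of the products is at most
    [e^(-j) q^e] ([weight_le]), and [K] about [e^(j/e)] makes both contributions
    of order [e^(-j/e)]; a factor [1 + e] is absorbed in [j^C].

    Oscillation: put [M = (K + 2)!] and compare the consecutive integers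
    [n = M^2] and [n + 1], which are 0 and 1 modulo every modulus in play.  Cut
    the range into blocks of length [M].  Every cut-off [n / x] with
    [x <= K + 2] is a multiple of [M], so in each block outside the initial
    proportion [1 / (K + 2)] one sees, for both integers, a complete period of
    the union belonging to the same bound [Q] on the last quotient.  For [n] all classes
    contain 0, and a union of residue classes with prescribed moduli is smallest
    in that case ([window_min]); hence no block is worse for [n + 1].
    In the blocks with [Q = j + 2] there is a strict gain: the chains miss one
    number [m] of [2, ..., j + 2], the class of such a chain has [m] elements
    modulo [(j + 2)!], for [n] all these classes share 0, whereas for [n + 1] only
    [m = 2] and [m = 3] meet, in one element.  This gives at least [j - 1] more
    elements per [(j + 2)!] integers ([window_gap]) on a proportion
    [1 / ((j + 3) (j + 4))] of the range, that is [(j - 1) / (j + 4)!] in density.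
    Finally [K] tends to infinity. *)

(** * Chains of quotients and their residue classes *)

(** A pair [(b, P)] stands for the class of [n b] modulo [P], for every numerator [n]
    at once.  If [k] lies in the class [c], then [n - q k] lies in this one. *)
Definition quot_step (q : nat) (c : int * nat) : int * nat :=
  (1 - q%:Z * c.1, (q * c.2)%N).

(** One class for each chain of [j] quotients [2 <= q_1 < ... < q_j <= Q]; its modulus
    is their product.  The quotient 1 is excluded because [chains 0 0] is empty while
    [chains 1 0] is not. *)
Fixpoint chains (Q j : nat) : seq (int * nat) :=
  if Q is q.+1 then
    if j is i.+1 then chains q j ++ [seq quot_step Q c | c <- chains q i]
    else [:: (0, 1%N)]
  else [::].

Definition covers (n r : int) (c : int * nat) : bool :=
  (c.2 %| r - n * c.1)%Z.

Definition reached (F : seq (int * nat)) (n r : int) : bool :=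
  has (covers n r) F.

Lemma covers_step n k q c : (0 < q)%N ->
  covers n (n - q%:Z * k) (quot_step q c) = covers n k c.
Proof.
move=> q0; rewrite /covers /= PoszM.
have -> : n - q%:Z * k - n * (1 - q%:Z * c.1) = q%:Z * (- (k - n * c.1)) by ring.
by rewrite dvdz_mul2l ?dvdzE ?abszN //; lia.
Qed.

Lemma covers_step_dvd n r q c : covers n r (quot_step q c) -> (q %| n - r)%Z.
Proof.
rewrite /covers /= PoszM => /dvdzP[x E]; apply/dvdzP.
by exists (n * c.1 - x * c.2); rewrite mulrBl; move: E; lia.
Qed.

Lemma reached_step F n k q : (0 < q)%N ->
  reached [seq quot_step q c | c <- F] n (n - q%:Z * k) = reached F n k.
Proof.
by move=> q0; rewrite /reached has_map; apply: eq_has => c /=; apply: covers_step.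
Qed.

Lemma reached_step_dvd F n r q :
  reached [seq quot_step q c | c <- F] n r -> exists k : int, r = n - q%:Z * k.
Proof.
rewrite /reached has_map => /hasP[c _ /= /covers_step_dvd/dvdzP[k E]].
by exists k; rewrite mulrC -E; ring.
Qed.

Lemma reached_cat F G n r : reached (F ++ G) n r = reached F n r || reached G n r.
Proof. exact: has_cat. Qed.

Lemma chains_dvd Q j c : c \in chains Q j -> (c.2 %| Q`!)%N.
Proof.
elim: Q j c => [|Q IH] [|j] c //=; first by rewrite inE => /eqP->.
rewrite mem_cat => /orP[/IH h|/mapP[d /IH h ->]].
  by rewrite factS dvdn_mull.
by rewrite factS /= dvdn_mul.
Qed.

(** Recursion on the last, largest quotient, here [q + 1]. *)
Lemma reached_chainsP Q j n r :
  reflect (exists q (k : int), [/\ (q < Q)%N, r = n - q.+1%:Z * k &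
                                  reached (chains q j) n k])
          (reached (chains Q j.+1) n r).
Proof.
elim: Q => [|Q IH]; first by constructor => -[q [k []]].
rewrite [chains _ _]/= reached_cat; apply: (iffP orP).
  case=> [/IH[q [k [qQ rE h]]]|h].
    by exists q, k; split=> //; apply: ltnW.
  have [k rE] := reached_step_dvd h; exists Q, k; split=> //.
  by move: h; rewrite rE reached_step.
case=> q [k [qQ rE h]]; move: qQ; rewrite ltnS leq_eqVlt => /orP[/eqP qQ|qQ].
  by right; rewrite rE -qQ reached_step.
by left; apply/IH; exists q, k.
Qed.

Lemma chains_nil Q j : (Q <= j)%N -> chains Q j = [::].
Proof.
elim: Q j => [|Q IH] [|j] //= Qj; rewrite ltnS in Qj.
by rewrite (IH j) ?(IH j.+1) ?(leqW Qj).
Qed.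

(** The [b] of the least chain of quotients, [2, 3, ..., j + 1]. *)
Fixpoint first_residue (j : nat) : int :=
  if j is i.+1 then 1 - i.+2%:Z * first_residue i else 0.

Lemma chainsSS Q j :
  chains Q.+1 j.+1 = chains Q j.+1 ++ [seq quot_step Q.+1 c | c <- chains Q j].
Proof. by []. Qed.

Lemma chains_first j : chains j.+1 j = [:: (first_residue j, j.+1`!)].
Proof.
elim: j => // j IH; rewrite chainsSS chains_nil // IH.
by rewrite /quot_step (factS j.+1).
Qed.

(** The chains of [j + 1] quotients at most [j + 3] omit one number of
    [2, ..., j + 3]: either [j + 3] itself, which leaves the least chain, or a smaller one,
    and then the remaining quotients form a chain of the same kind one step down. *)
Lemma chains_second j :
  chains j.+3 j.+1 =
    (first_residue j.+1, j.+2`!) :: [seq quot_step j.+3 c | c <- chains j.+2 j].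
Proof. by rewrite chainsSS chains_first. Qed.

Lemma chains_mono Q Q' j : (Q <= Q')%N -> {subset chains Q j <= chains Q' j}.
Proof.
move/subnKC <-; elim: (Q' - Q)%N => [|d IH] c cQ; first by rewrite addn0.
rewrite addnS; case: j IH cQ => [|j] IH cQ; last first.
  by rewrite chainsSS mem_cat IH.
by have := IH c cQ; case: (Q + d)%N.
Qed.

(** * Iterated remainders as unions of residue classes *)

Lemma iterRem0P n r : (r \in iterRem 0 n) = (0 < r <= n %/ 2)%N.
Proof.
apply/imfsetP/idP => /= [[k + ->]|rn]; last by exists r => //; rewrite mem_iota; lia.
by rewrite mem_iota; lia.
Qed.

Lemma iterRemSP j n r :
  reflect (exists2 k, k \in iterRem j n & (0 < k)%N /\ r = (n %% k)%N)
          (r \in iterRem j.+1 n).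
Proof.
apply: (iffP idP) => [/imfsetP[k /= + ->]|[k kj [k0 ->]]].
  by rewrite !inE => /andP[k0 kj]; exists k => //; split=> //; rewrite lt0n.
by apply/imfsetP; exists k => //=; rewrite !inE kj andbT -lt0n.
Qed.

(** If [r = n mod k] is positive and [q] is the quotient, then [n - 1 = q k + (r - 1)], so
    the bound [(n - 1) / k - 1] belonging to [k] is [q - 1]: earlier quotients are smaller.
    Moreover [k > r] amounts to [r (q + 1) < n], that is [q <= (n - 1) / r - 1].  The element
    [n / 2] of the initial set escapes this description, but its only remainder is 0. *)
Lemma mem_iterRem n j r : (0 < r)%N -> (j = 0%N -> (r * 2)%N <> n) ->
  (r \in iterRem j n) = reached (chains (n.-1 %/ r).-1 j) n r.
Proof.
elim: j r => [|j IH] r r0 hr.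
  have {}hr := hr erefl; rewrite iterRem0P r0 /=.
  have -> : (r <= n %/ 2)%N = (0 < (n.-1 %/ r).-1)%N.
    rewrite leq_divRL //; have -> : (0 < (n.-1 %/ r).-1)%N = (2 <= n.-1 %/ r)%N by lia.
    by rewrite leq_divRL //; lia.
  case: (_.-1) => //= q; rewrite /covers /= mulr0 subr0 dvdzE /= dvd1n //.
apply/iterRemSP/reached_chainsP.
  case=> k kj [k0 rE].
  have rk : (r < k)%N by rewrite rE ltn_mod.
  have nE := divn_eq n k; rewrite -rE in nE.
  have hk : (k * 2)%N <> n.
    move=> E; have : (n %% k = 0)%N by rewrite -E modnMr.
    by rewrite -rE => r00; rewrite r00 in r0.
  rewrite IH // in kj.
  have qE : (n.-1 %/ k = n %/ k)%N.
    have -> : n.-1 = ((n %/ k) * k + r.-1)%N.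
      by rewrite {1}nE -[in LHS](prednK r0) addnS.
    by rewrite divnMDl // (divn_small (leq_ltn_trans (leq_pred r) rk)) addn0.
  rewrite qE in kj.
  have q1 : (0 < (n %/ k).-1)%N by case: (_.-1) kj => //; case: (j).
  exists (n %/ k).-1, k%:Z; split=> //; last first.
    by rewrite prednK; lia.
  rewrite prednK; last by lia.
  have : ((n %/ k).+1 <= n.-1 %/ r)%N.
    rewrite leq_divRL //; nia.
  lia.
case=> q [k [qQ rE kj]].
have h : (q.+2 * r <= n.-1)%N.
  rewrite -leq_divRL //; lia.
have k0 : 0 < k by nia.
have kE : k = `|k|%:Z by lia.
move: k0 kE rE kj; move: (absz k) => m k0 kE rE kj; subst k.
have rm : (r < m)%N by nia.
have nE : n = (q.+1 * m + r)%N by lia.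
exists m; last first.
  split; first by lia.
  by rewrite nE modnMDl modn_small.
have m0 : (0 < m)%N by lia.
rewrite IH //; last first.
  move=> _ E; have : (n %% m = 0)%N by rewrite -E modnMr.
  by rewrite nE modnMDl modn_small //; lia.
have -> : (n.-1 %/ m = q.+1)%N.
  have -> : n.-1 = (q.+1 * m + r.-1)%N by lia.
  by rewrite divnMDl // (divn_small (leq_ltn_trans (leq_pred r) rm)) addn0.
exact: kj.
Qed.

Lemma iterRem_le j n r : r \in iterRem j n -> (r <= n)%N.
Proof.
case: j => [|j]; first by rewrite iterRem0P; lia.
by case/iterRemSP => k _ [_ ->]; apply: leq_mod.
Qed.

Lemma iterRemS_lt j n r : r \in iterRem j.+1 n -> (r * 2 < n.+1)%N.
Proof.
elim: j r => [|j IH] r /iterRemSP[k + [k0 ->]].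
  by rewrite iterRem0P; have := ltn_pmod n k0; lia.
by move/IH; have := ltn_pmod n k0; lia.
Qed.

Lemma cardRem_count j n m : (forall r, r \in iterRem j n -> (r < m)%N) ->
  cardRem j n = count [in iterRem j n] (iota 0 m).
Proof.
move=> nm; rewrite -size_filter /cardRem; apply: perm_size.
apply: uniq_perm; rewrite ?filter_uniq ?iota_uniq ?fset_uniq //.
move=> r; rewrite mem_filter mem_iota add0n /=.
by case: (boolP (r \in _)) => //= /nm ->.
Qed.

(** * Counting residue classes in intervals *)

Lemma count_inj_le (T : eqType) (s t : seq T) (a b : pred T) (f : T -> T) :
  uniq s -> {in s, forall x, a x -> (f x \in t) && b (f x)} ->
  {in [seq x <- s | a x] &, injective f} -> (count a s <= count b t)%N.
Proof.
move=> us h fi; rewrite -!size_filter -(size_map f); apply: uniq_leq_size.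
  by rewrite map_inj_in_uniq ?filter_uniq.
move=> _ /mapP[x + ->]; rewrite mem_filter => /andP[ax xs].
by have /andP[ft bf] := h x xs ax; rewrite mem_filter bf.
Qed.

Lemma covers_period (M : nat) (n n' r r' : int) c : (c.2 %| M)%N ->
  (M %| n - n')%Z -> (M %| r - r')%Z -> covers n r c = covers n' r' c.
Proof.
move=> cM dn dr; rewrite /covers -!eqz_mod_dvd.
have cMz : (c.2%:Z %| M%:Z)%Z by rewrite dvdzE.
have /eqP en : (n == n' %[mod c.2])%Z by rewrite eqz_mod_dvd (dvdz_trans cMz).
have /eqP er : (r == r' %[mod c.2])%Z by rewrite eqz_mod_dvd (dvdz_trans cMz).
by rewrite er -modzMml en modzMml.
Qed.

Lemma reached_period F (M : nat) (n n' r r' : int) : {in F, forall c, (c.2 %| M)%N} ->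
  (M %| n - n')%Z -> (M %| r - r')%Z -> reached F n r = reached F n' r'.
Proof.
move=> FM dn dr; apply: eq_in_has => c /FM cM; exact: (covers_period cM).
Qed.

Lemma residue_inj (M x y : nat) :
  (x < M)%N -> (y < M)%N -> (M %| x%:Z - y%:Z)%Z -> x = y.
Proof.
move=> xM yM; rewrite -eqz_mod_dvd !modz_nat !modn_small // => /eqP[].
exact: id.
Qed.

Definition window (F : seq (int * nat)) (M : nat) (n a : int) : nat :=
  count (fun i : nat => reached F n (a + i%:Z)) (iota 0 M).

(** Reduction modulo [M] maps either period injectively into the other. *)
Lemma window_shift F M (n n' a b : int) : (0 < M)%N -> {in F, forall c, (c.2 %| M)%N} ->
  (M %| n - n')%Z -> window F M n a = window F M n' b.
Proof.
move=> M0 FM.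
suff le m m' x y : (M %| m - m')%Z -> (window F M m x <= window F M m' y)%N.
  move=> d; apply/eqP; rewrite eqn_leq !le //.
  by rewrite -opprB dvdzE abszN -dvdzE.
move=> d; apply: (@count_inj_le _ _ _ _ _ (fun i : nat => `|((x + i - y) %% M)%Z|%N)).
- exact: iota_uniq.
- move=> i _ ri; rewrite mem_iota /= add0n.
  have e0 : 0 <= ((x + i - y) %% M)%Z by apply: modz_ge0; lia.
  have e1 : ((x + i - y) %% M)%Z < M%:Z by apply: ltz_pmod; lia.
  apply/andP; split; first by lia.
  rewrite -(reached_period FM d _ : reached F m (x + i) = _) //.
  apply/dvdzP; exists ((x + i - y) %/ M)%Z.
  by have := divz_eq (x + i - y) M; lia.
- move=> i k; rewrite !mem_filter !mem_iota /= !add0n => /andP[_ iM] /andP[_ kM] e.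
  have : ((x + i - y) %% M)%Z = ((x + k - y) %% M)%Z.
    have := @modz_ge0 (x + i - y) M; have := @modz_ge0 (x + k - y) M; lia.
  move/eqP; rewrite eqz_mod_dvd => d'.
  by apply: (residue_inj iM kM); move: d'; congr (_ %| _)%Z; ring.
Qed.

Lemma count_blocks (a : pred nat) (s B M : nat) :
  count a (iota s (B * M)) = (\sum_(t < B) count a (iota (s + t * M) M))%N.
Proof.
elim: B => [|B IH]; first by rewrite big_ord0.
by rewrite big_ord_recr -IH /= mulSn addnC iotaD count_cat.
Qed.

Lemma window_mul F (k M : nat) (n : int) : (0 < M)%N ->
  {in F, forall c, (c.2 %| M)%N} ->
  window F (k * M) n 0 = (k * window F M n 0)%N.
Proof.
move=> M0 FM; rewrite /window count_blocks.
rewrite -[X in (X * _)%N](card_ord k) -sum_nat_const; apply: eq_bigr => t _.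
rewrite add0n -[X in iota X _]addn0 iotaDl count_map.
rewrite -/(window F M n 0) -(@window_shift F M n n (t * M)%N 0) ?subrr ?dvdz0 //.
Qed.

Lemma window_class (c : int * nat) (n : int) : (0 < c.2)%N ->
  window [:: c] c.2 n 0 = 1%N.
Proof.
move=> c0; rewrite /window.
have m0 := @modz_ge0 (n * c.1) c.2; have m1 := @ltz_pmod (n * c.1) c.2.
pose m := `|(n * c.1 %% c.2)%Z|%N.
have mE : m%:Z = (n * c.1 %% c.2)%Z by rewrite gez0_abs //; lia.
have mc : (m < c.2)%N by lia.
rewrite (@eq_in_count _ _ (pred1 m)); last first.
  move=> i; rewrite mem_iota add0n => /= ic.
  rewrite /covers orbF add0r -eqz_mod_dvd -mE modz_nat modn_small //.
rewrite count_uniq_mem ?iota_uniq // mem_iota add0n.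
by rewrite mc.
Qed.

Lemma count_class_ge (c : int * nat) (n : int) N : (0 < c.2)%N ->
  (N %/ c.2 <= count (fun r : nat => covers n r c) (iota 0 N))%N.
Proof.
move=> c0; have E := divn_eq N c.2; rewrite {2}E iotaD count_cat.
apply: leq_trans (leq_addr _ _).
have cP : {in [:: c], forall d : int * nat, (d.2 %| c.2)%N}.
  by move=> d; rewrite inE => /eqP->.
rewrite -[X in (X <= _)%N]muln1 -(window_class n c0) -window_mul //.
by rewrite leq_eqVlt; apply/orP; left; apply/eqP/eq_count => i; rewrite /= orbF add0r.
Qed.

Lemma count_class_le (c : int * nat) (n : int) N : (0 < c.2)%N ->
  (count (fun r : nat => covers n r c) (iota 0 N) <= (N %/ c.2).+1)%N.
Proof.
move=> c0.
have cP : {in [:: c], forall d : int * nat, (d.2 %| c.2)%N}.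
  by move=> d; rewrite inE => /eqP->.
rewrite -[X in (_ <= X)%N]muln1 -(window_class n c0) -window_mul //.
have NE : ((N %/ c.2).+1 * c.2 = N + ((N %/ c.2).+1 * c.2 - N))%N.
  by rewrite subnKC // ltnW // ltn_ceil.
rewrite NE /window iotaD count_cat; apply: leq_trans (leq_addr _ _).
by rewrite leq_eqVlt; apply/orP; left; apply/eqP/eq_count => i; rewrite /= orbF add0r.
Qed.

Lemma count_has_le (S T : Type) (p : S -> pred T) (s : seq S) (t : seq T) :
  (count (fun x => has (p^~ x) s) t <= \sum_(y <- s) count (p y) t)%N.
Proof.
elim: s => [|y s IH]; first by rewrite big_nil count_pred0.
rewrite big_cons /=; apply: leq_trans (leq_add (leqnn _) IH).
exact: (leq_trans (leq_addr _ _) (eq_leq (count_predUI _ _ t))).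
Qed.

(** * The union of residue classes is smallest when all contain zero *)

Lemma dvdz_part p (m : nat) (x : int) : (0 < m)%N ->
  (m %| x)%Z = ((m`_p)%N %| x)%Z && ((m`_p^')%N %| x)%Z.
Proof.
move=> m0; rewrite -Gauss_dvdz; last by rewrite coprimezE coprime_partC.
by rewrite -PoszM partnC.
Qed.

(** Replace the numerator by one that vanishes at [p] and is unchanged modulo the part of
    [M] prime to [p].  Fix a residue modulo that part: only the classes compatible with it
    matter, and at [p] they become nested, so that their new union is the one with the smallest
    power of [p].  A translate of that very set was already contained in the old union, hence
    the count does not increase. *)
Lemma window_prime_le F (M p : nat) (n : int) : (0 < M)%N ->
  {in F, forall c, (c.2 %| M)%N} ->
  exists n' : int, [/\ ((M`_p)%N %| n')%Z, forall d : int, (d %| n)%Z -> (d %| n')%Z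
                     & (window F M n' 0 <= window F M n 0)%N].
Proof.
move=> M0 FM.
have F0 : {in F, forall c, (0 < c.2)%N} by move=> c /FM; apply: dvdn_gt0.
(* The idempotent which is 1 at p and 0 away from p. *)
pose e := chinese (M`_p)%N (M`_p^')%N 1 0.
have cop : coprime (M`_p)%N (M`_p^')%N by apply: coprime_partC.
have e1 : ((M`_p)%N %| e%:Z - 1)%Z.
  rewrite -eqz_mod_dvd !modz_nat; apply/eqP; congr Posz.
  exact: chinese_modl.
have e0 : ((M`_p^')%N %| e%:Z)%Z.
  by rewrite dvdzE /= /dvdn chinese_modr // mod0n.
exists (n * (1 - e%:Z)); split.
- by rewrite dvdz_mull // -opprB dvdzE abszN -dvdzE.
- by move=> d dn; rewrite dvdz_mulr.
(* Among the classes compatible with r away from p, the one with the smallest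
   power of p in its modulus.  It depends only on r modulo the part of M prime to
   p, hence r |-> r + n b e, with b taken from this class, is injective. *)
pose leq_p := relpre (fun c : int * nat => logn p c.2) leq.
pose G := sort leq_p F.
pose sel (r : int) :=
  head (0, 1%N) [seq c <- G | ((c.2`_p^')%N %| r - n * c.1)%Z].
have selP (r : nat) : reached F (n * (1 - e%:Z)) (0 + r%:Z) ->
    [/\ sel r \in F, (((sel r).2`_p^')%N %| r%:Z - n * (sel r).1)%Z &
        (((sel r).2`_p)%N %| r%:Z)%Z].
  rewrite add0r => /hasP[c cF]; rewrite /covers (dvdz_part p _ (F0 c cF)).
  case/andP=> h1 h2.
  have cz : (((c.2`_p)%N)%:Z %| ((M`_p)%N)%:Z)%Z by rewrite dvdzE partn_dvd // FM.
  have cz' : (((c.2`_p^')%N)%:Z %| ((M`_p^')%N)%:Z)%Z.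
    by rewrite dvdzE partn_dvd // FM.
  have {}h2 : ((c.2`_p^')%N %| r%:Z - n * c.1)%Z.
    have -> : r%:Z - n * c.1 = (r%:Z - n * (1 - e%:Z) * c.1) - n * c.1 * e%:Z.
      by ring.
    by rewrite rpredB // dvdz_mull // (dvdz_trans cz').
  have {}h1 : ((c.2`_p)%N %| r%:Z)%Z.
    have -> : r%:Z = (r%:Z - n * (1 - e%:Z) * c.1) - n * c.1 * (e%:Z - 1) by ring.
    by rewrite rpredB // dvdz_mull // (dvdz_trans cz).
  have cS : c \in [seq c <- G | ((c.2`_p^')%N %| r%:Z - n * c.1)%Z].
    by rewrite mem_filter h2 mem_sort.
  have sS : sorted leq_p [seq c <- G | ((c.2`_p^')%N %| r%:Z - n * c.1)%Z].
    apply: sorted_filter; first by move=> x y z; apply: leq_trans.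
    by apply: sort_sorted => x y; apply: leq_total.
  rewrite /sel; move: cS sS.
  case E : [seq c <- G | _] => [//|d s] cS sS /=.
  have : d \in d :: s by rewrite mem_head.
  rewrite -E mem_filter mem_sort => /andP[dr dF]; split => //.
  suff dc : (((d.2`_p)%N)%:Z %| ((c.2`_p)%N)%:Z)%Z by rewrite (dvdz_trans dc).
  rewrite dvdzE /= !p_part dvdn_exp2l //.
  move: cS; rewrite inE => /orP[/eqP->//|cs].
  have tr : transitive leq_p by move=> x y z; apply: leq_trans.
  by have /allP := order_path_min tr sS; apply.
rewrite /window; apply: (@count_inj_le _ _ _ _ _
  (fun r : nat => `|((r%:Z + n * (sel r).1 * e%:Z) %% M)%Z|%N)).
- exact: iota_uniq.
- move=> r _ /selP; rewrite mem_iota /= add0n.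
  pose x := r%:Z + n * (sel r).1 * e%:Z; case=> sF h1 h2.
  have x0 : 0 <= (x %% M)%Z by apply: modz_ge0; lia.
  have x1 : (x %% M)%Z < M%:Z by apply: ltz_pmod; lia.
  apply/andP; split; first by rewrite -ltz_nat gez0_abs.
  rewrite -[(_ %% M)%Z]/(x %% M)%Z.
  have -> : 0 + `|(x %% M)%Z|%N%:Z = (x %% M)%Z by rewrite add0r gez0_abs.
  rewrite (@reached_period F M n n (x %% M)%Z x) ?subrr ?dvdz0 //; last first.
    by rewrite -eqz_mod_dvd modz_mod.
  have sz : ((((sel r).2`_p)%N)%:Z %| ((M`_p)%N)%:Z)%Z by rewrite dvdzE partn_dvd // FM.
  have sz' : ((((sel r).2`_p^')%N)%:Z %| ((M`_p^')%N)%:Z)%Z.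
    by rewrite dvdzE partn_dvd // FM.
  apply/hasP; exists (sel r) => //; rewrite /covers (dvdz_part p _ (F0 _ sF)).
  have -> : x - n * (sel r).1 = r%:Z + n * (sel r).1 * (e%:Z - 1) by rewrite /x; ring.
  apply/andP; split; first by rewrite rpredD // dvdz_mull // (dvdz_trans sz).
  have -> : r%:Z + n * (sel r).1 * (e%:Z - 1)
    = (r%:Z - n * (sel r).1) + n * (sel r).1 * e%:Z by ring.
  by rewrite rpredD // dvdz_mull // (dvdz_trans sz').
- move=> r s; rewrite !mem_filter !mem_iota /= !add0n => /andP[_ rM] /andP[_ sM].
  pose x := r%:Z + n * (sel r).1 * e%:Z; pose y := s%:Z + n * (sel s).1 * e%:Z.
  rewrite -/x -/y => exy.
  have dxy : (M %| x - y)%Z.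
    rewrite -eqz_mod_dvd; apply/eqP.
    by have := @modz_ge0 x M; have := @modz_ge0 y M; lia.
  have drs : ((M`_p^')%N %| r%:Z - s%:Z)%Z.
    have -> : r%:Z - s%:Z = (x - y) - n * ((sel r).1 - (sel s).1) * e%:Z.
      by rewrite /x /y; ring.
    rewrite rpredB // ?dvdz_mull //; apply: dvdz_trans dxy.
    by rewrite dvdzE dvdn_part.
  have selE : sel r = sel s.
    rewrite /sel; congr head; apply: eq_in_filter => c; rewrite mem_sort => cF.
    have cz' : (((c.2`_p^')%N)%:Z %| ((M`_p^')%N)%:Z)%Z.
      by rewrite dvdzE partn_dvd // FM.
    rewrite -[r%:Z - _](subrK (s%:Z - n * c.1)) rpredDl //.
    have -> : r%:Z - n * c.1 - (s%:Z - n * c.1) = r%:Z - s%:Z by ring.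
    by rewrite (dvdz_trans cz').
  by apply: (residue_inj rM sM); move: dxy; rewrite /x /y selE; congr (_ %| _)%Z; ring.
Qed.

(** Rogers' theorem on the density of unions of residue classes, in the case of residues
    proportional to [n]: make them zero one prime at a time. *)
Lemma window_min F (M : nat) (n : int) : (0 < M)%N ->
  {in F, forall c, (c.2 %| M)%N} -> (window F M 0 0 <= window F M n 0)%N.
Proof.
move=> M0 FM.
have [n' [dn' le]] : exists n' : int,
    {in primes M, forall p : nat, ((M`_p)%N %| n')%Z} /\ (window F M n' 0 <= window F M n 0)%N.
  elim: (primes M) => [|p s [m [dm le]]]; first by exists n.
  have [m' [pm' dm' le']] := window_prime_le p m M0 FM.
  exists m'; split; last exact: leq_trans le' le.
  by move=> q; rewrite inE => /orP[/eqP->//|qs]; apply/dm'/dm.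
rewrite (leq_trans _ le) // (@window_shift F M 0 n' 0 0) // sub0r dvdzE abszN.
by apply/dvdn_partP => // p /dn'; rewrite dvdzE.
Qed.

(** * The gap between the numerators 0 and 1 *)

Lemma not_dvd1 (q z : int) : 1 < q -> q * z <> 1.
Proof. by move=> q1 E; case: (ltgtP z 0) => [z0|z0|z0]; nia. Qed.

(** For the numerator 0 the new class of multiples of [(j + 2)!] shares the element 0 with the
    others, so that it adds at most [j + 2] elements to a period. *)
Lemma window0_second_le j :
  (window (chains j.+3 j.+1) j.+3`! 0 0
     <= window (chains j.+2 j) j.+2`! 0 0 + j.+2)%N.
Proof.
rewrite /window -!size_filter.
set X := [seq _ <- iota 0 j.+3`! | _]; set Y := [seq _ <- iota 0 j.+2`! | _].
pose L := [seq (j.+3 * x)%N | x <- Y] ++ [seq (j.+2`! * s.+1)%N | s <- iota 0 j.+2].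
have -> : (size Y + j.+2 = size L)%N by rewrite size_cat !size_map size_iota.
have f0 := fact_gt0 j.+2.
apply: uniq_leq_size; first by rewrite filter_uniq ?iota_uniq.
move=> r; rewrite mem_filter mem_iota add0n add0r chains_second /=.
case/andP=> /orP[hP|rP] rN; rewrite mem_cat; last first.
  apply/orP; left.
  have [k rE] := reached_step_dvd rP.
  move: rP; rewrite rE reached_step // => kP.
  have rk : (r = j.+3 * `|k|)%N by lia.
  apply/mapP; exists `|k|%N => //; rewrite mem_filter mem_iota add0r.
  apply/and3P; split=> //; last first.
    by move: rN; rewrite rk (factS j.+2) ltn_pmul2l.
  case/hasP: kP => c cP kP; apply/hasP; exists c => //.
  by move: kP; rewrite /covers !mul0r !subr0 !dvdzE absz_id.
move: hP; rewrite /covers mul0r subr0 dvdzE !absz_nat => /dvdnP[[|s] rE].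
  apply/orP; left; apply/mapP; exists 0%N => //; last by rewrite rE mul0n muln0.
  rewrite mem_filter mem_iota addr0 f0 andbT.
  case: (j) => [//|i]; rewrite chains_second /= /covers mul0r subr0.
  by rewrite dvdz0.
apply/orP; right; apply/mapP; exists s; last by rewrite mulnC.
rewrite mem_iota add0n; move: rN; rewrite rE (factS j.+2) ltn_pmul2r //.
Qed.

(** For the numerator 1 the new class, of [j + 3] elements, is disjoint from the others when
    [j > 0].  A common element is [1 - (j + 3) x] with [x] in one of the earlier classes; being in
    the new class it is also 1 modulo [j + 2], so [j + 2] divides [x].  But either [x] is 1 modulo [j + 2], or [x]
    lies in the class of the least chain, and then [j + 1] divides a number
    which is 1 modulo [j + 1]. *)
Lemma window1_second_ge i (j := i.+1) :
  (window (chains j.+2 j) j.+2`! 1 0 + j.+3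
     <= window (chains j.+3 j.+1) j.+3`! 1 0)%N.
Proof.
rewrite /window -!size_filter.
set X := [seq _ <- iota 0 j.+3`! | _]; set Y := [seq _ <- iota 0 j.+2`! | _].
pose res (x : int) := `|(x %% j.+3`!)%Z|%N.
pose L := [seq res (1 - j.+3%:Z * x%:Z) | x <- Y]
  ++ [seq res (first_residue j.+1 + (j.+2)`!%:Z * s%:Z) | s <- iota 0 j.+3].
have -> : (size Y + j.+3 = size L)%N by rewrite size_cat !size_map size_iota.
have f0 := fact_gt0 j.+3.
have f0' := fact_gt0 j.+2.
have fE : (j.+3`!)%:Z = j.+3%:Z * (j.+2`!)%:Z by rewrite factS PoszM.
have fE' : (j.+2`!)%:Z = j.+2%:Z * (j.+1`!)%:Z by rewrite factS PoszM.
have fE'' : (j.+1`!)%:Z = j.+1%:Z * (j`!)%:Z by rewrite factS PoszM.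
have resP x : (res x < j.+3`!)%N /\ exists t, (res x)%:Z = x + t * (j.+3`!)%:Z.
  have := @modz_ge0 x (j.+3`!)%:Z; have := @ltz_pmod x (j.+3`!)%:Z.
  have := divz_eq x (j.+3`!)%:Z; rewrite /res => E h1 h2; split; first by lia.
  by exists (- (x %/ (j.+3`!)%:Z)%Z); lia.
have res_eq x y : res x = res y -> exists t, x = y + t * (j.+3`!)%:Z.
  have [_ [t tE]] := resP x; have [_ [u uE]] := resP y => e.
  by exists (u - t); move: tE uE; rewrite e mulrBl; lia.
have res_reached x :
    reached (chains j.+3 j.+1) 1 (res x) = reached (chains j.+3 j.+1) 1 x.
  have [_ [t tE]] := resP x.
  apply: (@reached_period _ (j.+3`!)); rewrite ?subrr ?dvdz0 //.
    by move=> c; apply: chains_dvd.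
  by apply/dvdzP; exists t; rewrite tE; lia.
apply: uniq_leq_size; last first.
  move=> r; rewrite mem_cat mem_filter mem_iota add0n add0r => /orP[/mapP[x]|/mapP[s _ ->]].
    rewrite mem_filter add0r => /andP[xP _] ->.
    rewrite (resP _).1 res_reached chains_second -cat1s reached_cat reached_step //.
    by rewrite xP orbT.
  rewrite (resP _).1 res_reached chains_second /= /covers /=.
  by rewrite mul1r addrC addKr dvdz_mulr.
rewrite cat_uniq; apply/and3P; split.
- rewrite map_inj_in_uniq ?filter_uniq ?iota_uniq // => x y.
  rewrite !mem_filter !mem_iota /= add0n => /andP[_ xN] /andP[_ yN].
  case/res_eq => t tE; apply/esym/(residue_inj yN xN)/dvdzP; exists t.
  have {}tE : y%:Z - x%:Z = t * (j.+2`!)%:Z.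
    have : j.+3%:Z * (y%:Z - x%:Z) = j.+3%:Z * (t * (j.+2`!)%:Z) by rewrite fE in tE; lia.
    by move/mulfI; apply.
  by [].
- apply/hasPn => _ /mapP[s _ ->]; apply/negP => /mapP[x].
  rewrite mem_filter add0r => /andP[xP _] /res_eq [t].
  rewrite [first_residue _]/= fE fE' => E.
  move: xP; rewrite /j chains_second -/j /= => /orP[].
    (* The least chain: reduce modulo j + 1. *)
    rewrite /covers /= mul1r fE'' => /dvdzP[k xE].
    set b := first_residue i in E xE; set f := (j`!)%:Z in E xE fE''.
    apply: (@not_dvd1 i.+2%:Z (b + f * (- j.+3%:Z * k - j.+2%:Z * s%:Z
       + t * j.+3%:Z * j.+2%:Z))); first by lia.
    have {}xE : x%:Z = 1 - i.+2%:Z * b + k * (j.+1%:Z * f) by rewrite -xE; ring.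
    move: E; rewrite xE fE'' => E.
    transitivity (1 + (j.+2%:Z * (1 - i.+2%:Z * b) - j.+2%:Z * (j.+1%:Z * f) * s%:Z
       + t * (j.+3%:Z * (j.+2%:Z * (j.+1%:Z * f)))
       - j.+3%:Z * (1 - i.+2%:Z * b + k * (j.+1%:Z * f)))).
      by rewrite /j; ring.
    by rewrite (_ : _ - _ = 0) ?addr0 //; lia.
  (* A last quotient j + 2: reduce modulo j + 2. *)
  case/reached_step_dvd => k xE.
  set b := 1 - _ * first_residue i in E; set f := (j.+1`!)%:Z in E.
  apply: (@not_dvd1 j.+2%:Z (b - f * s%:Z + t * j.+3%:Z * f + j.+3%:Z * k - 1)).
    by lia.
  move: E; rewrite xE => E.
  transitivity (1 + (j.+2%:Z * b - j.+2%:Z * f * s%:Z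
       + t * (j.+3%:Z * (j.+2%:Z * f)) - j.+3%:Z * (1 - j.+2%:Z * k))).
    by ring.
  by rewrite (_ : _ - _ = 0) ?addr0 //; lia.
- rewrite map_inj_in_uniq ?iota_uniq // => x y.
  rewrite !mem_iota /= add0n => xN yN.
  case/res_eq => t; rewrite fE => tE; apply: (residue_inj xN yN); apply/dvdzP; exists t.
  have {}tE : x%:Z - y%:Z = t * j.+3%:Z.
    have : (x%:Z - y%:Z) * (j.+2`!)%:Z = t * j.+3%:Z * (j.+2`!)%:Z by lia.
    by move/mulIf; apply; lia.
  by [].
Qed.

(** The two counts satisfy the inequality for [j = 0], and each step adds at most [j + 3] elements
    for the numerator 0 but at least [j + 4] for the numerator 1. *)
Lemma window_gap j :
  (window (chains j.+3 j.+1) j.+3`! 0 0 + j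
     <= window (chains j.+3 j.+1) j.+3`! 1 0)%N.
Proof.
elim: j => [//|j IH].
by have := window0_second_le j.+1; have := window1_second_ge j; lia.
Qed.

(** * Comparing two consecutive integers block by block *)

Lemma eq_divn a r x : (x * r <= a)%N -> (a < x.+1 * r)%N -> (a %/ r = x)%N.
Proof.
move=> h1 h2; have r0 : (0 < r)%N by case: r h2 {h1} => //; rewrite muln0.
by apply/eqP; rewrite eqn_leq -ltnS ltn_divLR // h2 leq_divRL.
Qed.

Lemma fact_dvd m n : (m <= n)%N -> (m`! %| n`!)%N.
Proof. by move/bin_fact => <-; rewrite mulnC -mulnA dvdn_mulr. Qed.

Section Blocks.
Variables (B M K : nat).
Hypothesis B0 : (0 < B)%N.
Hypothesis M0 : (0 < M)%N.
Hypothesis BK : forall x, (0 < x)%N -> (x <= K.+2)%N -> (x %| B)%N.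

(** As [B] is divisible by all [x <= K + 2], the condition [t x < B] already gives
    [(t + 1) x <= B].  So the cut-offs never fall inside a block. *)
Lemma block_bounds t : (B %/ K.+2 <= t)%N ->
  [/\ (0 < t)%N, (B.-1 %/ t <= K.+1)%N, (B <= (B.-1 %/ t).+1 * t)%N
    & (B.-1 %/ t * t.+1 <= B)%N].
Proof.
move=> tK.
have KB := BK (ltn0Sn K.+1) (leqnn _).
have t0 : (0 < t)%N by apply: leq_trans tK; rewrite divn_gt0 // dvdn_leq.
have tB : (B <= t * K.+2)%N by rewrite -leq_divLR.
have h1 := ltn_ceil B.-1 t0; have h2 := leq_trunc_div B.-1 t.
have h3 : (B.-1 %/ t <= K.+1)%N by rewrite -ltnS ltn_divLR //; lia.
split=> //; first by lia.
move: h2 h3; case E : (B.-1 %/ t)%N => [//|x] h2 h3.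
have /dvdnP[y yE] := BK (ltn0Sn x) (leqW h3).
rewrite yE mulnC leq_mul2r; apply/orP; right.
have : (x.+1 * t < x.+1 * y)%N by lia.
by rewrite ltn_pmul2l.
Qed.

Lemma block_quot0 t i : (B %/ K.+2 <= t)%N -> (i < M)%N ->
  ((B * M).-1 %/ (t * M + i) = B.-1 %/ t)%N.
Proof.
move=> /block_bounds[t0 _]; move: (_ %/ t)%N => x h1 h2 iM.
have h1' : (B * M <= x.+1 * t * M)%N by rewrite leq_mul2r h1 orbT.
have h2' : (x * t.+1 * M <= B * M)%N by rewrite leq_mul2r h2 orbT.
have BM : (0 < B * M)%N by rewrite muln_gt0 B0.
apply: eq_divn; last by nia.
by case: x {h1 h1'} h2 h2' => // x h2 h2'; nia.
Qed.

Lemma block_quot1 t i : (B %/ K.+2 <= t)%N -> (i < M)%N ->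
  ((B * M).+1.-1 %/ (1 + t * M + i) = B.-1 %/ t)%N.
Proof.
move=> /block_bounds[t0 _]; move: (_ %/ t)%N => x h1 h2 iM.
have h1' : (B * M <= x.+1 * t * M)%N by rewrite leq_mul2r h1 orbT.
have h2' : (x * t.+1 * M <= B * M)%N by rewrite leq_mul2r h2 orbT.
by apply: eq_divn; nia.
Qed.

Hypothesis MK : (K`! %| M)%N.

Lemma chains_period Q j : (Q <= K)%N -> {in chains Q j, forall c, (c.2 %| M)%N}.
Proof.
move=> QK c /chains_dvd h; apply: dvdn_trans h (dvdn_trans _ MK).
exact: fact_dvd.
Qed.

Lemma block_count0 j t : (B %/ K.+2 <= t)%N ->
  count [in iterRem j.+1 (B * M)] (iota (0 + t * M) M) =
  window (chains (B.-1 %/ t).-1 j.+1) M 0 0.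
Proof.
move=> tB; have [t0 tK _ _] := block_bounds tB.
rewrite add0n -[X in iota X _]addn0 iotaDl count_map.
apply: eq_in_count => i; rewrite mem_iota add0n => iM.
apply: etrans (mem_iterRem _ _) _ => //; first by rewrite addn_gt0 muln_gt0 t0 M0.
rewrite (block_quot0 tB iM); apply: (@reached_period _ M).
- by apply: chains_period; lia.
- by rewrite subr0 PoszM dvdz_mull.
- by rewrite add0r PoszD addrK PoszM dvdz_mull.
Qed.

Lemma block_count1 j t : (B %/ K.+2 <= t)%N ->
  count [in iterRem j.+1 (B * M).+1] (iota (1 + t * M) M) =
  window (chains (B.-1 %/ t).-1 j.+1) M 1 0.
Proof.
move=> tB; have [t0 tK _ _] := block_bounds tB.
have pP : {in chains (B.-1 %/ t).-1 j.+1, forall c, (c.2 %| M)%N}.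
  by apply: chains_period; lia.
rewrite (@window_shift _ M 1 1 0 (1 + t * M)%N) ?subrr ?dvdz0 //.
rewrite -[X in iota X _]addn0 iotaDl count_map.
apply: eq_in_count => i; rewrite mem_iota add0n => iM.
apply: etrans (mem_iterRem _ _) _ => //.
rewrite (block_quot1 tB iM); apply: (@reached_period _ M) => //.
- by rewrite -addn1 PoszD addrK PoszM dvdz_mull.
- by rewrite PoszD subrr dvdz0.
Qed.

(** The blocks [t < B / (K + 2)] are discarded, at a cost of [M] each.  On the others the count for
    [B M + 1] is at least the one for [B M] by minimality at 0, with the gain of
    [window_gap] in the blocks where the largest admissible quotient is [j + 3]. *)
Lemma cardRem_blocks j : (j.+3 <= K)%N ->
  (cardRem j.+1 (B * M)
      + (B %/ (j + 4) - B %/ (j + 5)) * (M %/ j.+3`! * j)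
    <= cardRem j.+1 (B * M).+1 + B %/ K.+2 * M)%N.
Proof.
move=> jK.
pose s0 t := count [in iterRem j.+1 (B * M)] (iota (0 + t * M) M).
pose s1 t := count [in iterRem j.+1 (B * M).+1] (iota (1 + t * M) M).
have e0 : cardRem j.+1 (B * M) = (\sum_(t < B) s0 t)%N.
  rewrite -count_blocks; apply: cardRem_count => r /iterRemS_lt.
  have : (0 < B * M)%N by rewrite muln_gt0 B0.
  by lia.
have e1 : (\sum_(t < B) s1 t <= cardRem j.+1 (B * M).+1)%N.
  rewrite -count_blocks (@cardRem_count _ _ (B * M).+2); last first.
    by move=> r /iterRem_le.
  have -> : iota 0 (B * M).+2 = 0%N :: iota 1 (B * M) ++ [:: (B * M).+1].
    by rewrite -[(B * M).+1 in LHS]addn1 /= iotaD.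
  by rewrite -cat1s !count_cat addnCA leq_addr.
have sum_ind (T T' g : nat) : (T' <= B)%N ->
    (\sum_(t < B) (T <= t < T') * g = (T' - T) * g)%N.
  move=> T'B; rewrite -big_distrl /=; congr (_ * _)%N.
  have -> : (T' - T = minn T' B - T)%N by lia.
  by elim: (B) => [|N IH]; rewrite ?big_ord0 ?big_ord_recr /= ?IH; lia.
have T0B : (B %/ K.+2 <= B)%N by apply: leq_div.
have T1B : (B %/ (j + 4) <= B)%N by apply: leq_div.
rewrite e0 (leq_trans _ (leq_add e1 (leqnn _))) //.
rewrite -(sum_ind _ _ _ T1B) -[(B %/ K.+2)%N]subn0 -(sum_ind _ _ _ T0B).
rewrite -!big_split /=; apply: leq_sum => t _.
have T0T : (B %/ K.+2 <= B %/ (j + 5))%N by apply: leq_div2l; lia.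
have [tT|Tt] := ltnP t (B %/ K.+2).
  have -> : (B %/ (j + 5) <= t)%N = false by lia.
  rewrite andFb mul0n addn0 mul1n (leq_trans _ (leq_addl _ _)) //.
  by rewrite /s0 (leq_trans (count_size _ _)) // size_iota.
rewrite mul0n addn0 /s0 /s1 block_count0 // block_count1 //.
have [t0 tK _ _] := block_bounds Tt.
have pP : {in chains (B.-1 %/ t).-1 j.+1, forall c, (c.2 %| M)%N}.
  by apply: chains_period; lia.
case: (boolP (_ <= t < _)%N) => [/andP[Tt1 tT2]|_]; last first.
  by rewrite mul0n addn0 window_min.
have -> : (B.-1 %/ t = j.+4)%N.
  apply: eq_divn.
    move: tT2; rewrite leq_divRL; lia.
  by move: Tt1; rewrite leq_divLR; [lia|apply: BK; lia].
have Mj : (j.+3`! %| M)%N by apply: dvdn_trans (fact_dvd jK) MK.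
rewrite mul1n; case/dvdnP: Mj => k ->.
rewrite mulnK ?fact_gt0 // !(@window_mul _ k j.+3`!) ?fact_gt0 //; try exact: chains_dvd.
by rewrite -mulnDr leq_mul2l; apply/orP; right; exact: window_gap.
Qed.
End Blocks.

(** With [M = B = (K + 2)!] all divisions in the block comparison are exact. *)
Lemma cardRem_jump j K n : (j.+3 <= K)%N -> n = (K.+2`! ^ 2)%N ->
  (cardRem j.+1 n + j * (n %/ (j + 5)`!)
    <= cardRem j.+1 n.+1 + n %/ K.+2)%N.
Proof.
move=> jK; set M := K.+2`! => nE.
have M0 : (0 < M)%N by apply: fact_gt0.
have BK x : (0 < x)%N -> (x <= K.+2)%N -> (x %| M)%N.
  by move=> x0 xK; apply: dvdn_fact; rewrite x0.
have := @cardRem_blocks M M K M0 M0 BK (fact_dvd (leqW (leqnSn K))) j jK.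
rewrite mulnn -nE.
have -> : (M %/ K.+2 * M = n %/ K.+2)%N.
  by rewrite nE -mulnn mulnC muln_divA // BK.
suff -> : ((M %/ (j + 4) - M %/ (j + 5)) * (M %/ j.+3`! * j) = j * (n %/ (j + 5)`!))%N by [].
have /dvdnP[a aE] : ((j + 5)`! %| M)%N by apply: fact_dvd; lia.
have fE : ((j + 5)`! = (j + 5) * ((j + 4) * j.+3`!))%N.
  by rewrite [in LHS]addnS factS !addnS addn0 factS.
have f0 := fact_gt0 j.+3; have f5 := fact_gt0 (j + 5).
move: f0 fE; move: (j.+3`!) => f f0 fE.
have -> : (M %/ (j + 4) = a * (j + 5) * f)%N.
  by apply/eqP; rewrite -(eqn_pmul2r (_ : 0 < j + 4)%N) ?divnK ?BK ?aE ?fE; lia.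
have -> : (M %/ (j + 5) = a * (j + 4) * f)%N.
  by apply/eqP; rewrite -(eqn_pmul2r (_ : 0 < j + 5)%N) ?divnK ?BK ?aE ?fE; lia.
have -> : (M %/ f = a * (j + 5) * (j + 4))%N.
  by rewrite aE fE !mulnA mulnK.
have -> : (n %/ (j + 5)`! = a * M)%N by rewrite nE -mulnn {1}aE mulnAC mulnK.
by rewrite aE fE; nia.
Qed.

(** * Cardinality bounds *)

(** Count only the class of the least chain [2, ..., j + 2]. *)
Lemma cardRem_ge j n :
  ((n.-1 %/ j.+3).+1 %/ j.+2`! <= (cardRem j.+1 n).+1)%N.
Proof.
have f0 := fact_gt0 j.+2.
apply: leq_trans (@count_class_ge (first_residue j.+1, j.+2`!) n _ f0) _.
rewrite (@cardRem_count _ _ n.+1); last by move=> r /iterRem_le.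
rewrite -[iota 0 _]/(0%N :: iota 1 _) -cat1s count_cat -[X in (_ <= X)%N]add1n.
apply: leq_add; first by rewrite /= addn0 leq_b1.
apply: (@count_inj_le _ _ _ _ _ id); rewrite ?iota_uniq //.
move=> r; rewrite !mem_iota add1n => /andP[r1 rN] cr.
have rn : (j.+3 * r <= n.-1)%N by rewrite mulnC -leq_divRL.
apply/andP; split.
  by have : (r <= j.+3 * r)%N by [rewrite leq_pmull]; lia.
change (r \in iterRem j.+1 n); rewrite mem_iterRem //.
apply/hasP; exists (first_residue j.+1, j.+2`!) => //.
apply: (@chains_mono j.+2); last by rewrite chains_first mem_head.
by have : (j.+3 <= n.-1 %/ r)%N by [rewrite leq_divRL]; lia.
Qed.

(** Elements whose last quotient exceeds [K] are at most [n / (K + 2)]; the others are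
    counted class by class, a class with last quotient [q + 1] being cut off at [n / (q + 2)]. *)
Lemma cardRem_le j n K :
  (cardRem j.+1 n <= (n %/ K.+2).+1 +
     \sum_(q <- iota 0 K) \sum_(c <- chains q j)
        ((n %/ q.+2).+1 %/ (q.+1 * c.2)).+1)%N.
Proof.
pose p q (c : int * nat) (r : nat) := (r <= n %/ q.+2)%N && covers n r (quot_step q.+1 c).
pose a (r : nat) := (r <= n %/ K.+2)%N.
pose b (r : nat) := has (fun q => has (fun c => p q c r) (chains q j)) (iota 0 K).
rewrite (@cardRem_count _ _ n.+1); last by move=> r /iterRem_le.
have ci (P : pred nat) N :
    (count (fun r => (r <= N)%N && P r) (iota 0 n.+1) <= count P (iota 0 N.+1))%N.
  apply: (@count_inj_le _ _ _ _ _ id); rewrite ?iota_uniq //.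
  by move=> r _ /andP[rN Pr]; rewrite mem_iota add0n ltnS rN.
have -> : count [in iterRem j.+1 n] (iota 0 n.+1) =
    count (predI (predU a b) [in iterRem j.+1 n]) (iota 0 n.+1).
  apply: eq_in_count => r _; rewrite /= andb_idl // => rI0.
  have rI : r \in iterRem j.+1 n by exact: rI0.
  have [r0|r0] := posnP r; first by rewrite /a r0.
  move: rI; rewrite mem_iterRem // => /reached_chainsP[q [k [qQ rE kP]]].
  have h : (q.+2 * r <= n.-1)%N by rewrite -leq_divRL //; lia.
  have [Kq|qK] := leqP K q.
    rewrite /a leq_divRL //; suff -> : (r * K.+2 <= n)%N by [].
    by have : (r * K.+2 <= r * q.+2)%N by [rewrite leq_mul2l; apply/orP; right; lia]; lia.
  apply/orP; right; apply/hasP; exists q; first by rewrite mem_iota.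
  case/hasP: kP => c cP ck; apply/hasP; exists c => //.
  by rewrite /p leq_divRL // rE covers_step // ck andbT; lia.
apply: leq_trans (_ : count (predU a b) (iota 0 n.+1) <= _)%N.
  by apply: sub_count => r /andP[].
apply: leq_trans (leq_addr (count (predI a b) (iota 0 n.+1)) _) _.
rewrite count_predUI; apply: leq_add.
  have := ci predT (n %/ K.+2)%N; rewrite count_predT size_iota; apply: leq_trans.
  by apply: sub_count => r; rewrite /= andbT.
apply: leq_trans (count_has_le _ _ _) _; apply: leq_sum => q _.
apply: leq_trans (count_has_le _ _ _) _; rewrite !big_seq; apply: leq_sum => c cP.
apply: leq_trans (ci _ _) _; apply: (@count_class_le (quot_step q.+1 c)).
by rewrite muln_gt0 /=; apply: dvdn_gt0 (chains_dvd cP); apply: fact_gt0.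
Qed.

Lemma cardRem_leq j n : (0 < n)%N -> (cardRem j.+1 n <= n)%N.
Proof.
move=> n0; rewrite (@cardRem_count _ _ n).
  by rewrite (leq_trans (count_size _ _)) // size_iota.
by move=> r /iterRemS_lt; lia.
Qed.

Lemma leq_cardRem j n : (n <= (cardRem j.+1 n + 2) * j.+3`!)%N.
Proof.
have h := cardRem_ge j n; have f0 := fact_gt0 j.+2.
have h1 := ltn_ceil n.-1 (ltn0Sn j.+2).
have h2 := ltn_ceil (n.-1 %/ j.+3).+1 f0.
move: h h1 h2; rewrite (factS j.+2); move: (j.+2`!) f0 => f f0.
move: (n.-1 %/ j.+3)%N => N; move: (N.+1 %/ f)%N => k kc hN hk.
have {}hN : (n <= N.+1 * j.+3)%N by lia.
apply: leq_trans hN _; rewrite mulnCA mulnC leq_mul2l; apply/orP; right.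
apply: leq_trans (ltnW hk) _; rewrite leq_mul2r; apply/orP; right; lia.
Qed.

(** * Upper and lower limits of sequences with values in the unit interval *)

Section LimSup.
Variables (R : realType) (u : R^nat).
Hypothesis u01 : forall n, 0 <= u n <= 1.

Lemma unit_bounded : bounded_fun u.
Proof.
exists 1; split; rewrite ?num_real // => M M1 n _ /=; apply: le_trans (ltW M1).
by have /andP[u0 u1] := u01 n; rewrite ger0_norm.
Qed.

Lemma limn_sup_le a : (forall e, 0 < e -> exists N, forall n, (N <= n)%N -> u n <= a + e) ->
  limn_sup u <= a.
Proof.
move=> h; apply/ler_addgt0Pr => e /h[N hN].
rewrite limn_supE; last exact: unit_bounded.
apply: (@le_trans _ _ (sups u N)).
  apply: ge_inf; last by exists N.
  exact/bounded_fun_has_lbound_sups/unit_bounded.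
apply: ge_sup; first by exists (u N), N => /=.
by move=> _ [n /= Nn <-]; apply: hN.
Qed.

Lemma limn_inf_ge a : (forall e, 0 < e -> exists N, forall n, (N <= n)%N -> a - e <= u n) ->
  a <= limn_inf u.
Proof.
move=> h; apply/ler_addgt0Pr => e /h[N hN]; rewrite -lerBlDr.
rewrite limn_infE; last exact: unit_bounded.
apply: (@le_trans _ _ (infs u N)); last first.
  apply: ub_le_sup; last by exists N.
  exact/bounded_fun_has_ubound_infs/unit_bounded.
apply: lb_le_inf; first by exists (u N), N => /=.
by move=> _ [n /= Nn <-]; apply: hN.
Qed.

Lemma limn_osc_ge d :
  (forall e N, 0 < e -> exists m n, [/\ (N <= m)%N, (N <= n)%N & d - e <= u m - u n]) ->
  d <= limn_sup u - limn_inf u.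
Proof.
move=> h.
rewrite lerBrDr limn_supE ?limn_infE; [|exact: unit_bounded..].
apply: lb_le_inf; first by exists (sups u 0), 0%N.
move=> _ [N _ <-]; rewrite -lerBrDl.
apply: ge_sup; first by exists (infs u 0), 0%N.
move=> _ [M _ <-]; rewrite lerBrDr -lerBrDl.
apply/ler_addgt0Pr => e /(h _ (maxn N M))[m [n []]].
rewrite !geq_max => /andP[Nm _] /andP[_ Mn] le; rewrite -lerBlDr.
apply: le_trans le _; apply: lerB.
  apply: ub_le_sup; last by exists m.
  by exists 1 => _ [k _ <-]; have /andP[] := u01 k.
apply: ge_inf; last by exists n.
by exists 0 => _ [k _ <-]; have /andP[] := u01 k.
Qed.
End LimSup.

(** * Densities *)

Section Real.
Variable R : realType.

Lemma remDensity_unit j n : 0 <= remDensity R j.+1 n <= 1.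
Proof.
rewrite /remDensity; case: n => [|n]; first by rewrite invr0 mulr0 lexx ler01.
rewrite divr_ge0 //= ler_pdivrMr ?ltr0n // mul1r ler_nat.
exact: cardRem_leq.
Qed.

(** The elementary symmetric polynomial of degree [j] in the reciprocals of [2, ..., Q]. *)
Definition weight (Q j : nat) : R := \sum_(c <- chains Q j) (c.2%:R)^-1.

(** Bernoulli's inequality with [1 / (q + 1)] for [1 / q], which makes it follow from
    [1 + y <= exp y] alone, applied at [- 1 / (q + 1)] and at [x / (q + 1)]. *)
Lemma powR_succ_ge (q : nat) (x : R) : 0 <= x ->
  q%:R `^ x * (1 + x / q.+1%:R) <= q.+1%:R `^ x.
Proof.
move=> x0; have q0 : (0 : R) < q.+1%:R by rewrite ltr0n.
have h : (q%:R : R) <= q.+1%:R * expR (- (q.+1%:R)^-1).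
  have := expR_ge1Dx (- (q.+1%:R)^-1 : R); rewrite -(ler_pM2l q0); apply: le_trans.
  by rewrite mulrDr mulr1 mulrN mulfV ?gt_eqF // -natr1 addrK.
have {}h : q%:R `^ x <= q.+1%:R `^ x * expR (- (x / q.+1%:R)).
  have -> : - (x / q.+1%:R) = - (q.+1%:R)^-1 * x by rewrite mulNr mulrC.
  rewrite expRM -powRM ?expR_ge0 ?ler0n //.
  by apply: ge0_ler_powR; rewrite ?nnegrE ?mulr_ge0 ?expR_ge0.
apply: le_trans (ler_wpM2r _ h) _.
  by rewrite addr_ge0 // divr_ge0.
rewrite -mulrA ler_piMr ?powR_ge0 // expRN mulrC ler_pdivrMr ?expR_gt0 // mul1r.
exact: expR_ge1Dx.
Qed.

(** Rankin's trick: the [j]-th elementary symmetric polynomial is at most [x^(-j)] times the product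
    of the [1 + x / m], which grows like [Q^x]; the value [x = e] is the one that gives the best
    exponent in the end. *)
Lemma weight_le Q j : weight Q j <= expR (- j%:R) * Q%:R `^ expR 1.
Proof.
elim: Q j => [|Q IH] [|j]; rewrite /weight.
- by rewrite big_nil mulr_ge0 ?expR_ge0 ?powR_ge0.
- by rewrite big_nil mulr_ge0 ?expR_ge0 ?powR_ge0.
- rewrite big_seq1 invr1 oppr0 expR0 mul1r -[leLHS](powRr0 Q.+1%:R).
  by apply: ler_powR; rewrite ?expR_ge0 // ler1n.
rewrite chainsSS big_cat big_map /=.
under [X in _ + X]eq_bigr do rewrite /quot_step /= natrM invfM.
rewrite -mulr_sumr -/(weight _ _) -/(weight _ _).
have h := powR_succ_ge Q (ltW (expR_gt0 (1 : R))).
apply: le_trans (ler_wpM2l (expR_ge0 _) h).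
apply: le_trans (lerD (IH _) (ler_wpM2l _ (IH _))) _.
  by rewrite invr_ge0.
have -> : expR (- j%:R : R) = expR (- j.+1%:R) * expR 1.
  by rewrite -expRD -natr1 opprD subrK.
by rewrite le_eqVlt; apply/orP; left; apply/eqP; ring.
Qed.

(** The number of chains below [K] does not depend on [n], so rounding errors are
    [O(1 / n)]. *)
Lemma remDensity_le j n K : (0 < n)%N ->
  remDensity R j.+1 n <= (K.+2%:R)^-1
     + \sum_(q <- iota 0 K) (q.+2%:R * q.+1%:R)^-1 * weight q j
     + (1 + \sum_(q <- iota 0 K) \sum_(c <- chains q j) 2) / n%:R.
Proof.
move=> n0; have nR : (0 : R) < n%:R by rewrite ltr0n.
have fl (a d : nat) : (0 < d)%N -> (a %/ d)%:R <= a%:R / d%:R :> R.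
  move=> d0; rewrite ler_pdivlMr ?ltr0n // -natrM ler_nat; exact: leq_trunc_div.
rewrite /remDensity ler_pdivrMr // mulrDl divfK ?gt_eqF // mulrDl.
apply: (@le_trans _ _ (((n %/ K.+2).+1 +
     \sum_(q <- iota 0 K) \sum_(c <- chains q j)
        ((n %/ q.+2).+1 %/ (q.+1 * c.2)).+1)%N%:R)); first by rewrite ler_nat cardRem_le.
rewrite natrD -natr1 [X in _ <= X]addrACA; apply: lerD.
  by rewrite lerD2r mulrC fl.
rewrite natr_sum mulr_suml -big_split /=; apply: ler_sum => q _.
rewrite natr_sum mulrAC /weight mulr_sumr -big_split /=.
rewrite big_seq [X in _ <= X]big_seq; apply: ler_sum => c cP.
have c0 : (0 < c.2)%N by apply: dvdn_gt0 (chains_dvd cP); apply: fact_gt0.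
have d0 : (0 < q.+1 * c.2)%N by rewrite muln_gt0.
have d1 : (q.+1 * c.2)%:R^-1 <= 1 :> R by rewrite invf_le1 ?ltr0n // ler1n.
rewrite -natr1 -[2]/(1 + 1) addrA lerD2r; apply: le_trans (fl _ _ d0) _.
rewrite -natr1 mulrDl mul1r; apply: lerD => //.
rewrite natrM invfM mulrA; apply: ler_wpM2r; first by rewrite invr_ge0.
have -> : (q.+2%:R * q.+1%:R)^-1 * n%:R = n%:R / q.+2%:R / q.+1%:R :> R.
  by rewrite invfM; ring.
apply: ler_wpM2r; first by rewrite invr_ge0.
exact: fl.
Qed.

Lemma sum_weight_le j (K : nat) :
  \sum_(q <- iota 0 K) (q.+2%:R * q.+1%:R)^-1 * weight q j
    <= expR (- j%:R) * (K%:R `^ (expR 1 - 1)) :> R.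
Proof.
have e2 : (0 : R) <= expR 1 - 2 by have := expR_ge1Dx (1 : R); lra.
have -> : expR 1 - 1 = (expR 1 - 2) + 1 :> R by ring.
case: K => [|K]; first by rewrite big_nil mulr_ge0 ?expR_ge0 ?powR_ge0.
rewrite powRD ?pnatr_eq0 ?implybT // powRr1 //.
rewrite mulrA [X in _ <= X]mulrC -[X in X%:R * _](size_iota 0 K.+1) -sum1_size natr_sum mulr_suml.
rewrite big_seq [X in _ <= X]big_seq; apply: ler_sum => q.
rewrite mem_iota add0n mul1r => /= qK.
apply: le_trans (ler_wpM2l _ (weight_le q j)) _; first by rewrite invr_ge0 mulr_ge0.
rewrite mulrCA; apply: ler_wpM2l; first exact: expR_ge0.
case: q qK => [|q] qK.
  by rewrite powR0 ?gt_eqF ?expR_gt0 // mulr0 powR_ge0.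
set d := expR 1 - 2 in e2 *.
have -> : expR 1 = 2%:R + d by rewrite /d addrC subrK.
rewrite powRD ?pnatr_eq0 ?implybT // powR_mulrn // mulrA -[leRHS]mul1r.
apply: ler_pM; rewrite ?powR_ge0 ?mulr_ge0 ?invr_ge0 ?exprn_ge0 //.
  rewrite mulrC ler_pdivrMr ?mulr_gt0 ?ltr0n // mul1r -natrX -natrM ler_nat.
  by rewrite -mulnn leq_mul // leqW.
by apply: ge0_ler_powR; rewrite ?nnegrE // ler_nat ltnW.
Qed.

(** The cut-off [K = floor(e^((j+1)/e))] balances the two contributions. *)
Lemma limn_sup_remDensity j :
  limn_sup (remDensity R j.+1) <= (1 + expR 1) * expR (- (j.+1%:R / expR 1)).
Proof.
apply: limn_sup_le; first exact: remDensity_unit.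
move=> e e0.
pose x : R := expR (j.+1%:R / expR 1).
pose K := Num.trunc x.
have x0 : 0 <= x by apply: expR_ge0.
have /andP[Kx xK] := truncn_itv x0.
pose C : R := 1 + \sum_(q <- iota 0 K) \sum_(c <- chains q j) 2.
exists (Num.trunc (C / e)).+1 => n nC.
have n0 : (0 < n)%N by apply: leq_trans nC.
have nR : (0 : R) < n%:R by rewrite ltr0n.
apply: le_trans (remDensity_le j K n0) _; rewrite -/C.
apply: lerD; last first.
  rewrite ler_pdivrMr // mulrC -ler_pdivrMr //.
  apply: le_trans (ltW (truncnS_gt _)) _; by rewrite ler_nat.
rewrite mulrDl mul1r; apply: lerD.
  rewrite expRN lef_pV2 ?posrE ?ltr0n ?expR_gt0 //.
  by apply: le_trans (ltW xK) _; rewrite ler_nat leqW.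
apply: le_trans (sum_weight_le _ _) _.
have h : K%:R `^ (expR 1 - 1) <= x `^ (expR 1 - 1).
  by apply: ge0_ler_powR; rewrite ?nnegrE // subr_ge0; have := expR_ge1Dx (1 : R); lra.
apply: le_trans (ler_wpM2l (expR_ge0 _) h) _.
rewrite /x -expRM -!expRD ler_expR.
have e0' : expR 1 != 0 :> R by rewrite gt_eqF ?expR_gt0.
rewrite mulrBr mulr1 divfK //; have : j%:R + 1 = j.+1%:R :> R by [rewrite natr1]; lra.
Qed.

Lemma limn_inf_remDensity j : (j.+3`!%:R)^-1 <= limn_inf (remDensity R j.+1).
Proof.
apply: limn_inf_ge; first exact: remDensity_unit.
move=> e e0; exists (Num.trunc (2 / e)).+1 => n nC.
have n0 : (0 < n)%N by apply: leq_trans nC.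
have nR : (0 : R) < n%:R by rewrite ltr0n.
have fR : (0 : R) < j.+3`!%:R by rewrite ltr0n fact_gt0.
have ne : 2 <= e * n%:R.
  rewrite -ler_pdivrMl // mulrC; apply: le_trans (ltW (truncnS_gt _)) _.
  by rewrite ler_nat.
rewrite /remDensity ler_pdivlMr // mulrBl lerBlDr.
apply: le_trans (_ : (cardRem j.+1 n)%:R + 2 <= _); last by rewrite lerD2l.
rewrite mulrC ler_pdivrMr // -natrD -natrM ler_nat.
exact: leq_cardRem.
Qed.

Lemma limn_sup_inf_remDensity j :
  j%:R / (j + 5)`!%:R <= limn_sup (remDensity R j.+1) - limn_inf (remDensity R j.+1).
Proof.
apply: limn_osc_ge; first exact: remDensity_unit.
move=> e N e0.
pose K := (j.+3 + N + (Num.trunc (2 / e)).+1)%N.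
have KR : (0 : R) < K.+2%:R by rewrite ltr0n.
have tK : ((Num.trunc (2 / e)).+1 <= K.+2)%N by rewrite /K; lia.
have Ke : 2 / K.+2%:R <= e.
  rewrite ler_pdivrMr // -ler_pdivrMl // mulrC.
  by apply: le_trans (ltW (truncnS_gt _)) _; rewrite ler_nat.
pose n := (K.+2`! ^ 2)%N.
have KM : (K.+2 %| K.+2`!)%N by apply: dvdn_fact; rewrite leqnn.
have Kn : (K.+2 <= n)%N.
  by rewrite /n -mulnn (leq_trans (dvdn_leq (fact_gt0 _) KM)) // leq_pmull // fact_gt0.
have n0 : (0 < n)%N by apply: leq_trans Kn.
have nR : (0 : R) < n%:R by rewrite ltr0n.
have dn : ((j + 5)`! %| n)%N.
  have jK : (j + 5 <= K.+2)%N by rewrite /K; lia.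
  by rewrite /n -mulnn; apply: dvdn_mull; apply: fact_dvd.
have dK : (K.+2 %| n)%N by rewrite /n -mulnn dvdn_mull.
exists n.+1, n; split; [by rewrite /K in Kn; lia|by rewrite /K in Kn; lia|].
have jump : (cardRem j.+1 n)%:R + j%:R * (n%:R / (j + 5)`!%:R)
     <= (cardRem j.+1 n.+1)%:R + n%:R / K.+2%:R :> R.
  have jK : (j.+3 <= K)%N by rewrite /K; lia.
  have := cardRem_jump jK (erefl n).
  by rewrite -(ler_nat R) !natrD natrM !natf_div.
have le1 := cardRem_leq j (ltn0Sn n).
rewrite /remDensity.
set s := (cardRem j.+1 n)%:R in jump *; set s' := (cardRem j.+1 n.+1)%:R in jump *.
have {}le1 : s' <= n.+1%:R by rewrite ler_nat.
have h1 : s' / n%:R - n%:R^-1 <= s' / n.+1%:R.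
  have -> : s' / n%:R = s' / n.+1%:R + s' / n.+1%:R / n%:R.
    rewrite -[n.+1%:R]natr1; field.
    by rewrite gt_eqF //= gt_eqF // natr1 ltr0n.
  rewrite -addrA gerDl subr_le0 ler_pdivrMr // mulVf ?gt_eqF //.
  by rewrite ler_pdivrMr ?ltr0n // mul1r.
have h2 : (n%:R : R)^-1 <= K.+2%:R^-1 by rewrite lef_pV2 ?posrE // ler_nat.
have h3 : j%:R / (j + 5)`!%:R - K.+2%:R^-1 <= s' / n%:R - s / n%:R.
  rewrite -mulrBl ler_pdivlMr // mulrBl.
  have -> : j%:R / (j + 5)`!%:R * n%:R = j%:R * (n%:R / (j + 5)`!%:R) :> R by ring.
  rewrite lerBlDr addrAC lerBrDr [_^-1 * _]mulrC addrC [leLHS]addrC [leRHS]addrC; exact: jump.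
rewrite lerBlDr.
have h4 : s' / n%:R - s / n%:R <= s' / n.+1%:R - s / n%:R + n%:R^-1 by rewrite addrAC lerD2r -lerBlDr.
have h5 : 2 / K.+2%:R = K.+2%:R^-1 + K.+2%:R^-1 :> R by ring.
rewrite lerBlDr in h3; apply: le_trans h3 _.
apply: le_trans (lerD h4 (lexx _)) _; rewrite -addrA lerD2l.
by apply: le_trans (lerD h2 (lexx _)) _; rewrite -h5.
Qed.
End Real.

Theorem theorem1p2 (R : realType) :
  [/\ forall j : nat, (2 <= j)%N ->
        (j%:R - 1) / ((j + 4)`!)%:R <= DeltaP R j,
      forall j : nat, (2 <= j)%N -> ~ cvgn (remDensity R j) &
      exists C : R, 0 < C /\
        forall j : nat, (2 <= j)%N ->
          [/\ 1 / ((j + 2)`!)%:R <= limn_inf (remDensity R j),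
              limn_inf (remDensity R j) <= limn_sup (remDensity R j) &
              limn_sup (remDensity R j)
                <= expR (- (j%:R / expR 1) + C * ln j%:R)]].
Proof.
have gap (j : nat) : (2 <= j)%N -> (j%:R - 1) / ((j + 4)`!)%:R <= DeltaP R j.
  case: j => // j _; rewrite -natr1 addrK addSnnS.
  exact: limn_sup_inf_remDensity.
have gap_gt0 (j : nat) : (2 <= j)%N -> 0 < DeltaP R j.
  move=> j2; apply: lt_le_trans (gap j j2).
  by rewrite divr_gt0 ?ltr0n ?fact_gt0 // subr_gt0 ltr1n.
have ln2 : 0 < ln (2 : R) by rewrite ln_gt0 // ltr1n.
have e1 : 1 < 1 + expR (1 : R) by rewrite ltrDl expR_gt0.
split=> //.
  move=> j j2 cj; have := gap_gt0 j j2.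
  by rewrite /DeltaP cvg_limn_supE // cvg_limn_infE // subrr ltxx.
(* As ln j >= ln 2, this C absorbs the factor 1 + e. *)
exists (ln (1 + expR 1) / ln 2); split; first by rewrite divr_gt0 // ln_gt0.
move=> j j2; split.
- case: j j2 => // j _; rewrite div1r addn2; exact: limn_inf_remDensity.
- by rewrite -subr_ge0 ltW // gap_gt0.
case: j j2 => // j j2; apply: le_trans (limn_sup_remDensity R j) _.
rewrite expRD mulrC ler_wpM2l ?expR_ge0 //.
rewrite -[leLHS]lnK ?posrE ?(lt_trans ltr01) // ler_expR.
rewrite -[leLHS](divfK (lt0r_neq0 ln2)) ler_wpM2l //.
  by rewrite ltW // divr_gt0 // ln_gt0.
by rewrite ler_ln ?posrE ?ltr0n // ler_nat.
Qed.
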